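(* Let $\mathcal C$ be a modular tensor category and $p_1,\dots,p_n\in I$. Define $T:\mathrm{Bl}(p_1,\dots,p_n)\to\mathrm{Bl}(p_1,\dots,p_n)$ by $$T\big|_{\mathrm{Hom}_{\mathcal C}(p_1\otimes\cdots\otimes p_n,\,i\otimes i^\ast)}=\frac{\theta_i}{\zeta}\cdot\mathrm{id}.$$ Then $T$ is exactly the restriction, to the summand of $\mathrm{Bl}(p_1,\dots,p_n)$ indexed by $i$, of the operator $T^{(p_1\otimes\cdots\otimes p_n)}$ (whose definition does not require its label to be simple).
   Context: $I$ is a complete set of representatives of the simple objects of $\mathcal C$, $0\in I$ the unit, $i^\ast$ the rigid dual, $d_i$ quantum dimensions, $\theta_i$ the (scalar) ribbon twist on $i$, and $\zeta=\bigl(\sum_i\theta_id_i/\sum_i\theta_i^{-1}d_i\bigr)^{1/6}$ (a fixed root; for $\mathcal C=\mathrm{Rep}\,L(k,0)$, $\zeta=e^{2\pi ic/24}$). $\mathrm{Bl}(p_1,\dots,p_n)=\bigoplus_{i\in I}\mathrm{Hom}_{\mathcal C}(p_1\otimes\cdots\otimes p_n,\,i\otimes i^\ast)$. For an object $P$ of $\mathcal C$, $T^{(P)}$ is the operator on $\bigoplus_{i\in I}\mathrm{Hom}_{\mathcal C}(P,i\otimes i^\ast)$ from the genus-one one-marked-point modular functor of Bakalov–Kirillov: on the $i$-th summand it post-composes with the twist on the strand $i$ of the $i,i^\ast$-loop, normalized by $\zeta^{-1}$, i.e. $f\mapsto\zeta^{-1}(\theta_i\otimes\mathrm{id}_{i^\ast})\circ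 f$, where here $\theta_i$ is the twist morphism of $i$. *)

(* Defs.v *)
From HB Require Import structures.
From mathcomp Require Import all_boot all_order all_algebra.

Set Implicit Arguments.
Unset Strict Implicit.
Unset Printing Implicit Defensive.

Import GRing.Theory.
Local Open Scope ring_scope.

Declare Scope cat_scope.
Delimit Scope cat_scope with cat.
Local Open Scope cat_scope.

(* A finite direct sum of vector spaces is realised as the space of dependent
   families; MathComp has no such lmodType instance. *)

Section DirectSum.
Variables (k : fieldType) (I : finType) (V : I -> lmodType k).

Definition dsum : Type := {dffun forall i : I, V i}.

Definition dsum_fam (F : forall i, V i) : dsum := [ffun i => F i].
Definition dsum_pr (i : I) (x : dsum) : V i := (x : {dffun forall i, V i}) i.

Lemma dsum_prE F i : dsum_pr i (dsum_fam F) = F i.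
Proof. exact: ffunE. Qed.

Lemma dsumP (x y : dsum) : (forall i, dsum_pr i x = dsum_pr i y) -> x = y.
Proof. by move=> h; apply/ffunP. Qed.

HB.instance Definition _ := Choice.copy dsum {dffun forall i : I, V i}.

Definition dsum_zero := dsum_fam (fun=> 0).
Definition dsum_opp x := dsum_fam (fun i => - dsum_pr i x).
Definition dsum_add x y := dsum_fam (fun i => dsum_pr i x + dsum_pr i y).
Definition dsum_scale (a : k) x := dsum_fam (fun i => a *: dsum_pr i x).

Fact dsum_addA : associative dsum_add.
Proof. by move=> x y z; apply: dsumP => i; rewrite !dsum_prE addrA. Qed.
Fact dsum_addC : commutative dsum_add.
Proof. by move=> x y; apply: dsumP => i; rewrite !dsum_prE addrC. Qed.
Fact dsum_add0 : left_id dsum_zero dsum_add.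
Proof. by move=> x; apply: dsumP => i; rewrite !dsum_prE add0r. Qed.
Fact dsum_addN : left_inverse dsum_zero dsum_opp dsum_add.
Proof. by move=> x; apply: dsumP => i; rewrite !dsum_prE addNr. Qed.

HB.instance Definition _ :=
  GRing.isZmodule.Build dsum dsum_addA dsum_addC dsum_add0 dsum_addN.

Fact dsum_scaleA a b x : dsum_scale a (dsum_scale b x) = dsum_scale (a * b) x.
Proof. by apply: dsumP => i; rewrite !dsum_prE scalerA. Qed.
Fact dsum_scale1 : left_id 1 dsum_scale.
Proof. by move=> x; apply: dsumP => i; rewrite !dsum_prE scale1r. Qed.
Fact dsum_scaleDr : right_distributive dsum_scale +%R.
Proof. by move=> a x y; apply: dsumP => i; rewrite !dsum_prE scalerDr. Qed.
Fact dsum_scaleDl x : {morph dsum_scale^~ x : a b / a + b}.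
Proof. by move=> a b; apply: dsumP => i; rewrite !dsum_prE scalerDl. Qed.

HB.instance Definition _ := GRing.Zmodule_isLmodule.Build k dsum
  dsum_scaleA dsum_scale1 dsum_scaleDr dsum_scaleDl.

Definition dsum_in (i : I) (v : V i) : dsum :=
  dsum_fam (dfwith (fun j => 0 : V j) v).

Definition dsum_map (phi : forall i, {linear V i -> V i}) (x : dsum) : dsum :=
  dsum_fam (fun i => phi i (dsum_pr i x)).

Fact dsum_map_linear phi : linear (dsum_map phi).
Proof.
move=> a x y; apply: dsumP => i.
by rewrite !dsum_prE linearP.
Qed.

HB.instance Definition _ phi :=
  GRing.isLinear.Build k dsum dsum *:%R (dsum_map phi) (dsum_map_linear phi).

End DirectSum.

Record linear_cat (k : fieldType) := LinearCat {
  obj :> Type;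
  mor : obj -> obj -> lmodType k;
  idm : forall X, mor X X;
  hcomp : forall X Y Z, mor Y Z -> mor X Y -> mor X Z;
  hcomp_linear_l : forall X Y Z (f : mor X Y),
    linear (fun g : mor Y Z => hcomp g f);
  hcomp_linear_r : forall X Y Z (g : mor Y Z),
    linear (fun f : mor X Y => hcomp g f);
  hcomp_idl : forall X Y (f : mor X Y), hcomp (idm Y) f = f;
  hcomp_idr : forall X Y (f : mor X Y), hcomp f (idm X) = f;
  hcompA : forall W X Y Z (h : mor Y Z) (g : mor X Y) (f : mor W X),
    hcomp h (hcomp g f) = hcomp (hcomp h g) f
}.

Arguments mor {k l} X Y.
Arguments idm {k l} X.
Arguments hcomp {k l X Y Z} g f.

Notation "g \oc f" := (hcomp g f) (at level 40, left associativity) : cat_scope.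

Section LinearCatTheory.
Variables (k : fieldType) (C : linear_cat k).

Definition are_inverse (X Y : C) (f : mor X Y) (g : mor Y X) : Prop :=
  g \oc f = idm X /\ f \oc g = idm Y.

Definition is_iso (X Y : C) (f : mor X Y) : Prop := exists g, are_inverse f g.

Definition isomorphic (X Y : C) : Prop := exists f : mor X Y, is_iso f.

Definition is_mono (X Y : C) (m : mor X Y) : Prop :=
  forall (W : C) (g h : mor W X), m \oc g = m \oc h -> g = h.

Definition is_epi (X Y : C) (e : mor X Y) : Prop :=
  forall (Z : C) (g h : mor Y Z), g \oc e = h \oc e -> g = h.

Definition is_zero (X : C) : Prop := idm X = 0.

(* The empty direct sum is the zero object. *)
Definition is_direct_sum (n : nat) (X : C) (Y : 'I_n -> C) : Prop :=
  exists (inj : forall j, mor (Y j) X) (prj : forall j, mor X (Y j)),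
    [/\ forall j, prj j \oc inj j = idm (Y j),
        forall i j, i != j -> prj j \oc inj i = 0
      & \sum_(j < n) inj j \oc prj j = idm X].

Definition is_kernel (K X Y : C) (m : mor K X) (f : mor X Y) : Prop :=
  f \oc m = 0 /\
  forall (W : C) (g : mor W X), f \oc g = 0 -> exists! h : mor W K, m \oc h = g.

Definition is_cokernel (X Y Q : C) (e : mor Y Q) (f : mor X Y) : Prop :=
  e \oc f = 0 /\
  forall (Z : C) (g : mor Y Z), g \oc f = 0 -> exists! h : mor Q Z, h \oc e = g.

Definition abelian_cat : Prop :=
  [/\ forall (n : nat) (Y : 'I_n -> C), exists X : C, is_direct_sum X Y,
      forall (X Y : C) (f : mor X Y),
        (exists (K : C) (m : mor K X), is_kernel m f) /\
        (exists (Q : C) (e : mor Y Q), is_cokernel e f),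
      forall (X Y : C) (m : mor X Y), is_mono m ->
        exists (Z : C) (f : mor Y Z), is_kernel m f
    & forall (X Y : C) (e : mor X Y), is_epi e ->
        exists (W : C) (f : mor W X), is_cokernel e f].

Definition simple_obj (X : C) : Prop :=
  ~ is_zero X /\
  forall (Y : C) (m : mor Y X), is_mono m -> is_zero Y \/ is_iso m.

Definition semisimple_cat : Prop :=
  forall X : C, exists (n : nat) (Y : 'I_n -> C),
    (forall j, simple_obj (Y j)) /\ is_direct_sum X Y.

(* End(X) = k for simple X; automatic over an algebraically closed field when
   the Hom spaces are finite-dimensional.  The boolean equality allows the
   scalar to be extracted with xchoose. *)
Definition split_cat : Prop :=
  forall X : C, simple_obj X ->
  forall f : mor X X, exists a : k, f == a *: idm X.

End LinearCatTheory.

Record monoidal_cat (k : fieldType) := MonoidalCat {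
  mon_cat :> linear_cat k;
  unit_obj : mon_cat;
  tens : mon_cat -> mon_cat -> mon_cat;
  tensm : forall X X' Y Y' : mon_cat,
    mor X X' -> mor Y Y' -> mor (tens X Y) (tens X' Y');
  tensm_linear_l : forall (X X' Y Y' : mon_cat) (g : mor Y Y'),
    linear (fun f : mor X X' => tensm f g);
  tensm_linear_r : forall (X X' Y Y' : mon_cat) (f : mor X X'),
    linear (fun g : mor Y Y' => tensm f g);
  tensm_id : forall X Y : mon_cat, tensm (idm X) (idm Y) = idm (tens X Y);
  tensm_comp : forall (X X' X'' Y Y' Y'' : mon_cat)
      (f' : mor X' X'') (f : mor X X') (g' : mor Y' Y'') (g : mor Y Y'),
    tensm (f' \oc f) (g' \oc g) = tensm f' g' \oc tensm f g;
  assoc : forall X Y Z : mon_cat,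
    mor (tens (tens X Y) Z) (tens X (tens Y Z));
  assoc_inv : forall X Y Z : mon_cat,
    mor (tens X (tens Y Z)) (tens (tens X Y) Z);
  assocK : forall X Y Z, are_inverse (assoc X Y Z) (assoc_inv X Y Z);
  assoc_nat : forall (X X' Y Y' Z Z' : mon_cat)
      (f : mor X X') (g : mor Y Y') (h : mor Z Z'),
    assoc X' Y' Z' \oc tensm (tensm f g) h =
    tensm f (tensm g h) \oc assoc X Y Z;
  lunit : forall X : mon_cat, mor (tens unit_obj X) X;
  lunit_inv : forall X : mon_cat, mor X (tens unit_obj X);
  lunitK : forall X, are_inverse (lunit X) (lunit_inv X);
  lunit_nat : forall (X X' : mon_cat) (f : mor X X'),
    lunit X' \oc tensm (idm unit_obj) f = f \oc lunit X;
  runit : forall X : mon_cat, mor (tens X unit_obj) X;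
  runit_inv : forall X : mon_cat, mor X (tens X unit_obj);
  runitK : forall X, are_inverse (runit X) (runit_inv X);
  runit_nat : forall (X X' : mon_cat) (f : mor X X'),
    runit X' \oc tensm f (idm unit_obj) = f \oc runit X;
  pentagon : forall W X Y Z : mon_cat,
    assoc W X (tens Y Z) \oc assoc (tens W X) Y Z =
    tensm (idm W) (assoc X Y Z) \oc assoc W (tens X Y) Z
      \oc tensm (assoc W X Y) (idm Z);
  triangle : forall X Y : mon_cat,
    tensm (idm X) (lunit Y) \oc assoc X unit_obj Y = tensm (runit X) (idm Y)
}.

Arguments unit_obj {k m}.
Arguments tens {k m} X Y.
Arguments tensm {k m X X' Y Y'} f g.
Arguments assoc {k m} X Y Z.
Arguments assoc_inv {k m} X Y Z.
Arguments lunit {k m} X.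
Arguments lunit_inv {k m} X.
Arguments runit {k m} X.
Arguments runit_inv {k m} X.

Notation "X \ox Y" := (tens X Y) (at level 38, left associativity) : cat_scope.
Notation "f \oxm g" := (tensm f g) (at level 38, left associativity)
  : cat_scope.

Record rigid_cat (k : fieldType) := RigidCat {
  rigid_mon :> monoidal_cat k;
  dual : rigid_mon -> rigid_mon;
  ev : forall X : rigid_mon, mor (dual X \ox X) unit_obj;
  coev : forall X : rigid_mon, mor unit_obj (X \ox dual X);
  dual_zigzag : forall X : rigid_mon,
    runit X \oc (idm X \oxm ev X) \oc assoc X (dual X) X
      \oc (coev X \oxm idm X) \oc lunit_inv X = idm X;
  dual_zagzig : forall X : rigid_mon,
    lunit (dual X) \oc (ev X \oxm idm (dual X)) \oc assoc_inv (dual X) X (dual X)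
      \oc (idm (dual X) \oxm coev X) \oc runit_inv (dual X) = idm (dual X)
}.

Arguments dual {k r} X.
Arguments ev {k r} X.
Arguments coev {k r} X.

Definition transpose (k : fieldType) (C : rigid_cat k) (X Y : C)
    (f : mor X Y) : mor (dual Y) (dual X) :=
  lunit (dual X) \oc (ev Y \oxm idm (dual X))
    \oc ((idm (dual Y) \oxm f) \oxm idm (dual X))
    \oc assoc_inv (dual Y) X (dual X)
    \oc (idm (dual Y) \oxm coev X) \oc runit_inv (dual Y).

(* One-sided duals suffice: the other ones come from the braiding. *)
Record ribbon_cat (k : fieldType) := RibbonCat {
  ribbon_rigid :> rigid_cat k;
  braid : forall X Y : ribbon_rigid, mor (X \ox Y) (Y \ox X);
  braid_iso : forall X Y, is_iso (braid X Y);
  braid_nat : forall (X X' Y Y' : ribbon_rigid) (f : mor X X') (g : mor Y Y'),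
    braid X' Y' \oc (f \oxm g) = (g \oxm f) \oc braid X Y;
  hexagon_l : forall X Y Z : ribbon_rigid,
    assoc Y Z X \oc braid X (Y \ox Z) \oc assoc X Y Z =
    (idm Y \oxm braid X Z) \oc assoc Y X Z \oc (braid X Y \oxm idm Z);
  hexagon_r : forall X Y Z : ribbon_rigid,
    assoc_inv Z X Y \oc braid (X \ox Y) Z \oc assoc_inv X Y Z =
    (braid X Z \oxm idm Y) \oc assoc_inv X Z Y \oc (idm X \oxm braid Y Z);
  twist : forall X : ribbon_rigid, mor X X;
  twist_iso : forall X, is_iso (twist X);
  twist_nat : forall (X Y : ribbon_rigid) (f : mor X Y),
    twist Y \oc f = f \oc twist X;
  twist_tens : forall X Y : ribbon_rigid,
    twist (X \ox Y) = braid Y X \oc braid X Y \oc (twist X \oxm twist Y);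
  twist_dual : forall X : ribbon_rigid, twist (dual X) = transpose (twist X)
}.

Arguments braid {k r} X Y.
Arguments twist {k r} X.

(* The left evaluation X (x) X^* -> 1 needed to close up f is
   ev \o braid \o (twist (x) id). *)
Definition qtrace (k : fieldType) (C : ribbon_cat k) (X : C) (f : mor X X)
    : mor (unit_obj : C) unit_obj :=
  ev X \oc braid X (dual X) \oc ((twist X \oc f) \oxm idm (dual X)) \oc coev X.

Record premodular_cat (k : fieldType) := PremodularCat {
  premod_ribbon :> ribbon_cat k;
  premod_abelian : abelian_cat premod_ribbon;
  premod_semisimple : semisimple_cat premod_ribbon;
  premod_split : split_cat premod_ribbon;
  unit_simple : simple_obj (unit_obj : premod_ribbon);
  irr_idx : finType;
  irr : irr_idx -> premod_ribbon;
  irr_simple : forall i, simple_obj (irr i);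
  irr_inj : forall i j, isomorphic (irr i) (irr j) -> i = j;
  irr_complete : forall X : premod_ribbon, simple_obj X ->
    exists i, isomorphic X (irr i);
  irr0 : irr_idx;
  irr0_unit : irr irr0 = unit_obj
}.

Arguments irr {k p} _.
Arguments irr0 {k p}.

Section Premodular.
Variables (k : fieldType) (C : premodular_cat k).
Local Notation I := (irr_idx C).

Definition endo_scalar (X : C) (sX : simple_obj X) (f : mor X X) : k :=
  xchoose (premod_split sX f).

Definition theta (i : I) : k := endo_scalar (irr_simple i) (twist (irr i)).

Definition qtrace_scalar (X : C) (f : mor X X) : k :=
  endo_scalar (unit_simple C) (qtrace f).

Definition qdim (i : I) : k := qtrace_scalar (idm (irr i)).

(* The Hopf link of colours i and j; replacing one colour by its dual only
   permutes the rows of the matrix below. *)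
Definition s_coef (i j : I) : k :=
  qtrace_scalar (braid (irr j) (irr i) \oc braid (irr i) (irr j)).

Definition s_matrix : 'M[k]_#|I| :=
  \matrix_(a, b) s_coef (enum_val a) (enum_val b).

End Premodular.

Record modular_cat (k : fieldType) := ModularCat {
  mod_premod :> premodular_cat k;
  s_invertible : s_matrix mod_premod \in unitmx
}.

Section GenusOne.
Variables (k : fieldType) (C : modular_cat k).
Local Notation I := (irr_idx C).

Definition loop_obj (i : I) : C := irr i \ox dual (irr i).

Definition genus1_space (P : C) : lmodType k :=
  dsum (fun i : I => mor P (loop_obj i)).

Definition summand_in (P : C) (i : I) (f : mor P (loop_obj i))
    : genus1_space P :=
  dsum_in (V := fun j : I => mor P (loop_obj j)) f.

(* p_1 (x) ... (x) p_n, bracketed to the left; the unit object if n = 0. *)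
Definition tens_irr (ps : seq I) : C :=
  if ps is p :: qs then foldl (fun X q => X \ox irr q) (irr p) qs
  else unit_obj.

Definition Bl (ps : seq I) : lmodType k := genus1_space (tens_irr ps).

Definition bk_T_summand (zeta : k) (P : C) (i : I) (f : mor P (loop_obj i))
    : mor P (loop_obj i) :=
  zeta^-1 *: ((twist (irr i) \oxm idm (dual (irr i))) \oc f).

Fact bk_T_summand_linear zeta P i : linear (@bk_T_summand zeta P i).
Proof.
move=> a f g; rewrite /bk_T_summand hcomp_linear_r scalerDr !scalerA.
by rewrite mulrC.
Qed.

HB.instance Definition _ zeta P i :=
  GRing.isLinear.Build k (mor P (loop_obj i)) (mor P (loop_obj i)) *:%R
    (@bk_T_summand zeta P i) (@bk_T_summand_linear zeta P i).

(* The operator T^(P), for P not necessarily simple. *)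
Definition bk_T (zeta : k) (P : C)
    : {linear genus1_space P -> genus1_space P} :=
  dsum_map (fun i => @bk_T_summand zeta P i).

Definition Bl_T (zeta : k) (ps : seq I) : {linear Bl ps -> Bl ps} :=
  dsum_map (fun i => ( *:%R (theta i / zeta)
    : {linear mor (tens_irr ps) (loop_obj i) ->
              mor (tens_irr ps) (loop_obj i)})).

End GenusOne.

Arguments bk_T {k C} zeta P.
Arguments Bl_T {k C} zeta ps.

(* Main.v *)
Require Import Defs.
From mathcomp Require Import all_boot all_order all_algebra.

Import GRing.Theory.
Local Open Scope ring_scope.
Local Open Scope cat_scope.

(** On a simple object the twist is the scalar [theta i] ([twist_irrE]). Tensor product and
    composition are bilinear, so this scalar leaves the twist on the strand [i] and only an identity
    remains; with the normalization, each summand is scaled by [theta i / zeta] ([bk_T_summandE]),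
    for any source object [P]. *)

Lemma twist_irrE (k : fieldType) (C : premodular_cat k) (i : irr_idx C) :
  twist (irr i) = theta i *: idm (irr i).
Proof. exact/eqP/(xchooseP (premod_split (irr_simple i) (twist (irr i)))). Qed.

Lemma tensmZl (k : fieldType) (C : monoidal_cat k) (X X' Y Y' : C) (a : k)
    (f : mor X X') (g : mor Y Y') : (a *: f) \oxm g = a *: (f \oxm g).
Proof.
(* [linear] is the single identity for [a *: x + y]. Taking [a = -1] and [x = y] shows that zero
   goes to zero; then [y = 0] isolates the scaling. *)
have tens0 : 0 \oxm g = 0 :> mor (X \ox Y) (X' \ox Y').
  by have := tensm_linear_l g (-1) f f; rewrite !scaleN1r !addNr.
by have := tensm_linear_l g a f 0; rewrite tens0 !addr0.
Qed.

Lemma hcompZl (k : fieldType) (C : linear_cat k) (X Y Z : C) (a : k)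
    (g : mor Y Z) (f : mor X Y) : (a *: g) \oc f = a *: (g \oc f).
Proof.
have comp0 : 0 \oc f = 0 :> mor X Z.
  by have := hcomp_linear_l f (-1) g g; rewrite !scaleN1r !addNr.
by have := hcomp_linear_l f a g 0; rewrite comp0 !addr0.
Qed.

Lemma bk_T_summandE (k : fieldType) (C : modular_cat k) (zeta : k) (P : C)
    (i : irr_idx C) (f : mor P (loop_obj i)) :
  bk_T_summand zeta f = (theta i / zeta) *: f.
Proof.
rewrite /bk_T_summand twist_irrE tensmZl tensm_id hcompZl hcomp_idl.
by rewrite scalerA mulrC.
Qed.

Local Close Scope cat_scope.

Theorem proposition6p2 (k : fieldType) (C : modular_cat k) (zeta : k)
    (hzeta : zeta ^+ 6 = (\sum_(i : irr_idx C) theta i * qdim i) /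
                         (\sum_(i : irr_idx C) (theta i)^-1 * qdim i))
    (n : nat) (p : n.-tuple (irr_idx C)) :
  forall (i : irr_idx C) (f : mor (tens_irr p) (loop_obj i)),
    Bl_T zeta p (summand_in f) = bk_T zeta (tens_irr p) (summand_in f).
Proof.
(* Both operators are diagonal for the direct sum, so they are compared in every component [j],
   whatever vector stands there. *)
move=> i f; apply: dsumP => j.
by rewrite !dsum_prE; apply/esym/bk_T_summandE.
Qed.
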